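(* Let $f$ be a quadratic unit as in the context. Then \[ j^{\rm qt}(f)=\{\,j(\mathfrak a_i): i=0,\dots,d-1\,\},\] where $\mathfrak a_i=(f,fT,\dots,fT^i)\subset A_{\infty_1}$.
   Context: Let $q$ be a prime power, $k=\mathbb F_q(T)$, $A=\mathbb F_q[T]$, $k_\infty=\mathbb F_q((1/T))$ with $|x|=q^{\deg_T x}$; $\|x\|$ is the distance from $x\in k_\infty$ to $A$. For $f\in k_\infty$ and $\varepsilon>0$ let $\Lambda_\varepsilon(f)=\{\lambda\in A:\|\lambda f\|<\varepsilon\}$, and $\zeta_{f,\varepsilon}(m)=\sum_{\lambda\in\Lambda_\varepsilon(f)\setminus\{0\},\ \lambda\text{ monic}}\lambda^{-m}$. Put $J_\varepsilon(f)=\frac{T^{q^2}-T}{(T^q-T)^{q+1}}\cdot\frac{\zeta_{f,\varepsilon}(q^2-1)}{\zeta_{f,\varepsilon}(q-1)^{q+1}}$ and $j_\varepsilon(f)=\big(\frac1{T^q-T}-J_\varepsilon(f)\big)^{-1}$. The quantum modular invariant $j^{\rm qt}(f)\subset k_\infty\cup\{\infty\}$ is the set of limits of convergent sequences $j_{\varepsilon_i}(f)$ with $\varepsilon_i\to0$. Now let $f\in k_\infty\setminus k$ be a quadratic unit: a root of $X^2-aX-b$ with $a\in A$ monic, $d:=\deg_T a\ge1$, $b\in\mathbb F_q^*$, with $|f|=q^d$. Let $K=k(f)\subset k_\infty$, $\infty_1$ the place of $K$ induced by this embedding, $A_{\infty_1}$ the ring of elements of $K$ regular away from $\infty_1$;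 one has $A_{\infty_1}=\mathbb F_q[f,fT,\dots,fT^{d-1}]$. An element of $A_{\infty_1}$ is monic if it can be written $c_0+c_1(T)f+\dots+c_k(T)f^k$ with $c_0\in\mathbb F_q$, $c_i\in A$ of degree $\le d-1$ for $i\ge1$, and $c_k$ monic (for $k=0$ this means the element is $1$). For a nonzero ideal $\mathfrak a\subset A_{\infty_1}$ let $\zeta^{\mathfrak a}(n(q-1))=\sum_{0\ne x\in\mathfrak a\text{ monic}}x^{n(1-q)}$, $J(\mathfrak a)=\frac{T^{q^2}-T}{(T^q-T)^{q+1}}\cdot\frac{\zeta^{\mathfrak a}(q^2-1)}{\zeta^{\mathfrak a}(q-1)^{q+1}}$ and $j(\mathfrak a)=\big(\frac1{T^q-T}-J(\mathfrak a)\big)^{-1}$. *)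

(* Defs.v *)
From HB Require Import structures.
From mathcomp Require Import all_boot all_order all_algebra.
From mathcomp Require Import boolp classical_sets reals.
Set Implicit Arguments. Unset Strict Implicit. Unset Printing Implicit Defensive.
Import Order.TTheory GRing.Theory Num.Theory.
Local Open Scope ring_scope.

Definition qF (F : finFieldType) : nat := #|F|.

Section Kinf.
Variables (F : finFieldType) (R : realType) (K : fieldType).
Variables (emb : {rmorphism {poly F} -> K}) (absv : K -> R).

Local Notation q := (qF F).

Definition in_k (x : K) : Prop :=
  exists u v : {poly F}, v != 0 /\ x = emb u / emb v.

Definition cvgK (u : nat -> K) (l : K) : Prop :=
  forall e : R, 0 < e -> exists N, forall n, (N <= n)%N -> absv (u n - l) < e.

(* (K, emb, absv) is the completion k_oo = F_q((1/T)) of k = F_q(T) at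
   infinity, with |x| = q^(deg x): a complete non-archimedean absolute value
   extending |p| = q^(deg p) on A, with k dense.  This determines
   (K, emb, absv) up to unique isometric isomorphism. *)
Definition kinf_axioms : Prop :=
  (forall x, 0 <= absv x) /\
  (forall x, (absv x == 0) = (x == 0)) /\
  (forall x y, absv (x * y) = absv x * absv y) /\
  (forall x y, absv (x + y) <= Num.max (absv x) (absv y)) /\
  (forall p : {poly F}, p != 0 -> absv (emb p) = (q%:R : R) ^+ (size p).-1) /\
  (forall u : nat -> K,
      (forall e : R, 0 < e -> exists N, forall m n, (N <= m)%N -> (N <= n)%N ->
          absv (u m - u n) < e) ->
      exists l, cvgK u l) /\
  (forall (x : K) (e : R), 0 < e ->
      exists u v : {poly F}, v != 0 /\ absv (x - emb u / emb v) < e).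

Definition distA (x : K) : R := inf (range (fun p : {poly F} => absv (x - emb p))).

Definition Tk : K := emb 'X.

Definition mpolyc (n : nat) (c : {ffun 'I_n -> F}) : {poly F} :=
  'X^n + \sum_(j < n) (c j)%:P * 'X^j.

Definition zeta_part (f : K) (eps : R) (m N : nat) : K :=
  \sum_(n < N.+1) \sum_(c : {ffun 'I_n -> F} | distA (emb (mpolyc c) * f) < eps)
      (emb (mpolyc c)) ^- m.

Definition is_zeta (f : K) (eps : R) (m : nat) (Z : K) : Prop :=
  cvgK (zeta_part f eps m) Z.

Definition J_of (Z1 Z2 : K) : K :=
  (Tk ^+ (q ^ 2) - Tk) / (Tk ^+ q - Tk) ^+ q.+1 * (Z2 / Z1 ^+ q.+1).

(* j = (1/(T^q-T) - J)^{-1} in k_oo \cup {oo}; None stands for oo *)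
Definition j_of (Z1 Z2 : K) : option K :=
  let D := (Tk ^+ q - Tk)^-1 - J_of Z1 Z2 in
  if D == 0 then None else Some D^-1.

Definition is_jeps (f : K) (eps : R) (z : option K) : Prop :=
  exists Z1 Z2, is_zeta f eps (q - 1) Z1 /\ is_zeta f eps (q ^ 2 - 1) Z2 /\
                z = j_of Z1 Z2.

Definition cvgP1 (u : nat -> option K) (z : option K) : Prop :=
  match z with
  | Some l => forall e : R, 0 < e -> exists N, forall n, (N <= n)%N ->
                exists y, u n = Some y /\ absv (y - l) < e
  | None => forall M : R, exists N, forall n, (N <= n)%N ->
                match u n with None => true | Some y => M < absv y end
  end.

Definition jqt (f : K) (z : option K) : Prop :=
  exists (eps : nat -> R) (js : nat -> option K),
    (forall i, 0 < eps i) /\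
    (forall e : R, 0 < e -> exists N, forall n, (N <= n)%N -> eps n < e) /\
    (forall i, is_jeps f (eps i) (js i)) /\
    cvgP1 js z.

Inductive inA1 (f : K) (d : nat) : K -> Prop :=
  | A1_const (c : F) : inA1 f d (emb c%:P)
  | A1_gen (j : nat) : (j < d)%N -> inA1 f d (f * Tk ^+ j)
  | A1_add x y : inA1 f d x -> inA1 f d y -> inA1 f d (x + y)
  | A1_mul x y : inA1 f d x -> inA1 f d y -> inA1 f d (x * y).

Definition inIdeal (f : K) (d i : nat) (x : K) : Prop :=
  exists r : 'I_i.+1 -> K, (forall j, inA1 f d (r j)) /\
    x = \sum_(j < i.+1) r j * (f * Tk ^+ j).

Definition polyv (d : nat) (v : 'rV[F]_d) : {poly F} :=
  \sum_(j < d) (v ord0 j)%:P * 'X^j.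

Definition elemA (f : K) (d k : nat) (c0 : F) (cs : {ffun 'I_k.+1 -> 'rV[F]_d}) : K :=
  emb c0%:P + \sum_(i < k.+1) emb (polyv (cs i)) * f ^+ i.+1.

(* All monic elements of A_{oo_1} that can be written with k <= N
   (k = 0 : the element 1; k >= 1 : c_k monic). *)
Definition monicA_list (f : K) (d N : nat) : seq K :=
  1 :: flatten [seq [seq elemA f c0 cs | c0 <- enum F,
                      cs <- [seq cs <- enum {: {ffun 'I_k.+1 -> 'rV[F]_d}}
                             | polyv ((cs : {ffun 'I_k.+1 -> 'rV[F]_d}) (@ord_max k)) \is monic]]
               | k <- iota 0 N].

Definition zetaA_part (f : K) (d i m N : nat) : K :=
  \sum_(x <- undup (monicA_list f d N) | (x != 0) && `[< inIdeal f d i x >])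
     x ^- m.

Definition is_zetaA (f : K) (d i m : nat) (Z : K) : Prop :=
  cvgK (zetaA_part f d i m) Z.

Definition is_jideal (f : K) (d i : nat) (z : option K) : Prop :=
  exists Z1 Z2, is_zetaA f d i (q - 1) Z1 /\ is_zetaA f d i (q ^ 2 - 1) Z2 /\
                z = j_of Z1 Z2.

End Kinf.

(* Main.v *)
(** Write f' for the conjugate of f; then f f' = -b and |f'| = q^-d.  On the
order A + A f, multiplication by the unit f scales the conjugate by f', and
dist(v f) = inf_u |u + v f'|.  So Lambda_eps is the set of v for which some
u + v f has a conjugate smaller than eps, while a_i is the set of elements of
A + A f whose conjugate is smaller than q^-(d-1-i).  As |f'| = q^-d, every small
Lambda_eps corresponds to f^N a_i for exactly one pair (N, i), and for x in a_i
the element of Lambda_eps attached to f^N x is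
(f^N x - f'^N x') / (f - f'), that is x f^N / (f - f') up to a relative error
which tends to 0.  Since J is homogeneous of degree 0, J_eps is close to
J(a_i), and every i occurs for arbitrarily small eps. *)
Require Import Defs.
From HB Require Import structures.
From mathcomp Require Import all_boot all_order all_algebra.
From mathcomp Require Import boolp classical_sets reals.
From mathcomp Require Import ring zify.
Set Implicit Arguments. Unset Strict Implicit. Unset Printing Implicit Defensive.
Import Order.TTheory GRing.Theory Num.Theory.
Local Open Scope ring_scope.

Section Kinf.
Variables (F : finFieldType) (R : realType) (K : fieldType).
Variables (emb : {rmorphism {poly F} -> K}) (absv : K -> R).
Hypothesis HK : kinf_axioms emb absv.

Local Notation q := (qF F).
Local Notation Q := (q%:R : R).

(** * The absolute value *)

Lemma absv_ge0 x : 0 <= absv x. Proof. by case: HK. Qed.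

Lemma absv_eq0 x : (absv x == 0) = (x == 0). Proof. by case: HK => _ []. Qed.

Lemma absvM x y : absv (x * y) = absv x * absv y.
Proof. by case: HK => _ [_ []]. Qed.

Lemma absvD x y : absv (x + y) <= Num.max (absv x) (absv y).
Proof. by case: HK => _ [_ [_ []]]. Qed.

Lemma qF_gt1 : (1 < q)%N. Proof. exact: card_finNzRing_gt1. Qed.

Lemma Q_gt1 : 1 < Q. Proof. by rewrite ltr1n qF_gt1. Qed.

Lemma Q_gt0 : 0 < Q. Proof. exact: lt_trans ltr01 Q_gt1. Qed.

Lemma Q_neq0 : Q != 0. Proof. by rewrite gt_eqF ?Q_gt0. Qed.

Lemma absv_emb p : p != 0 -> absv (emb p) = Q ^ ((size p)%:Z - 1).
Proof.
case: HK => _ [_ [_ [_ [h _]]]] p0; rewrite h // exprnP.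
by congr (_ ^ _); move: p0; rewrite -size_poly_gt0; lia.
Qed.

Lemma Qz_gt0 (z : int) : 0 < Q ^ z. Proof. by rewrite exprz_gt0 ?Q_gt0. Qed.

Lemma ltQ (z w : int) : (Q ^ z < Q ^ w) = (z < w).
Proof. exact: ltr_eXz2l Q_gt1 _ _. Qed.

Lemma leQ (z w : int) : (Q ^ z <= Q ^ w) = (z <= w).
Proof. exact: ler_eXz2l Q_gt1 _ _. Qed.

Lemma QD (z w : int) : Q ^ (z + w) = Q ^ z * Q ^ w.
Proof. by rewrite expfzDr // Q_neq0. Qed.

Lemma absv0 : absv 0 = 0. Proof. by apply/eqP; rewrite absv_eq0. Qed.

Lemma absv_gt0 x : (0 < absv x) = (x != 0).
Proof. by rewrite lt_def absv_eq0 absv_ge0 andbT. Qed.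

Lemma absv_const (c : F) : c != 0 -> absv (emb c%:P) = 1.
Proof. by move=> c0; rewrite absv_emb ?polyC_eq0 // size_polyC c0. Qed.

Lemma absv_const_le (c : F) : absv (emb c%:P) <= 1.
Proof.
have [->|c0] := eqVneq c 0; first by rewrite !raddf0 absv0 ler01.
by rewrite absv_const.
Qed.

Lemma absv1 : absv 1 = 1.
Proof. by rewrite -(rmorph1 emb) -(@absv_const 1) ?oner_neq0. Qed.

Lemma absvN x : absv (- x) = absv x.
Proof.
rewrite -mulN1r absvM -(rmorphN1 emb) -polyCN absv_const ?mul1r //.
by rewrite oppr_eq0 oner_neq0.
Qed.

Lemma absv_distC x y : absv (x - y) = absv (y - x).
Proof. by rewrite -absvN opprB. Qed.

Lemma absvX x n : absv (x ^+ n) = absv x ^+ n.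
Proof. by elim: n => [|n IH]; rewrite ?absv1 // !exprS absvM IH. Qed.

Lemma absvV x : absv x^-1 = (absv x)^-1.
Proof.
have [->|x0] := eqVneq x 0; first by rewrite invr0 absv0 invr0.
have a0 : absv x != 0 by rewrite absv_eq0.
by apply: (mulfI a0); rewrite -absvM !divff ?absv1.
Qed.

Lemma absvD_lt x y B : absv x < B -> absv y < B -> absv (x + y) < B.
Proof. by move=> hx hy; apply: le_lt_trans (absvD x y) _; rewrite gt_max hx. Qed.

Lemma absvD_le x y B : absv x <= B -> absv y <= B -> absv (x + y) <= B.
Proof. by move=> hx hy; apply: le_trans (absvD x y) _; rewrite ge_max hx. Qed.

Lemma absvB_lt x y B : absv x < B -> absv y < B -> absv (x - y) < B.
Proof. by move=> hx hy; apply: absvD_lt; rewrite ?absvN. Qed.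

Lemma absvD_eqr x y : absv x < absv y -> absv (x + y) = absv y.
Proof.
move=> lt; apply/eqP; rewrite eq_le absvD_le ?(ltW lt) //= leNgt; apply/negP=> h.
by have := absvB_lt h lt; rewrite addrC addKr ltxx.
Qed.

Lemma absv_sum_le (I : Type) (r : seq I) (P : pred I) (G : I -> K) B :
  0 <= B -> (forall i, P i -> absv (G i) <= B) ->
  absv (\sum_(i <- r | P i) G i) <= B.
Proof.
move=> B0 h; elim/big_ind: _ => //; first by rewrite absv0.
by move=> x y; exact: absvD_le.
Qed.

Lemma absv_emb_lt1 p : absv (emb p) < 1 -> p = 0.
Proof.
have [//|p0] := eqVneq p 0.
rewrite absv_emb // -[1](expr0z Q) ltQ; move: p0; rewrite -size_poly_gt0; lia.
Qed.

Lemma absv_emb_ge (p : {poly F}) n : (n < size p)%N -> Q ^ n%:Z <= absv (emb p).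
Proof.
move=> h; rewrite absv_emb ?leQ; first lia.
by rewrite -size_poly_gt0; lia.
Qed.

Lemma absv_emb_le (p : {poly F}) n : (size p <= n)%N -> absv (emb p) <= Q ^ (n%:Z - 1).
Proof.
have [->|p0] := eqVneq p 0; first by rewrite raddf0 absv0 ltW ?Qz_gt0.
by move=> h; rewrite absv_emb // leQ; lia.
Qed.

(** By density some quotient of polynomials is closer to [x] than [absv x], so it has the same
    absolute value, a power of q. *)
Lemma absv_value_group x : x != 0 -> exists z : int, absv x = Q ^ z.
Proof.
move=> x0; have [_ [_ [_ [_ [_ [_ dense]]]]]] := HK.
have ax : 0 < absv x by rewrite absv_gt0.
have [u [v [v0 h]]] := dense x _ ax.
have e : absv (emb u / emb v) = absv x.
  have := @absvD_eqr (emb u / emb v - x) x; rewrite subrK; apply.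
  by rewrite absv_distC.
have u0 : u != 0.
  by apply/eqP => u0; move: h; rewrite u0 raddf0 mul0r subr0 ltxx.
exists ((size u)%:Z - 1 - ((size v)%:Z - 1)).
by rewrite -e absvM absvV !absv_emb // invr_expz -QD.
Qed.

Lemma absv_lt_discrete x (z : int) : (absv x < Q ^ z) = (absv x <= Q ^ (z - 1)).
Proof.
have [->|x0] := eqVneq x 0; first by rewrite absv0 Qz_gt0 ltW ?Qz_gt0.
have [w ->] := absv_value_group x0; rewrite ltQ leQ; lia.
Qed.

Lemma Qpow_small (e : R) : 0 < e -> exists N, forall n, (N <= n)%N -> Q ^ (- n%:Z) < e.
Proof.
move=> e0; exists (Num.bound e^-1) => n hn.
rewrite -invr_expz -exprnP invf_plt ?posrE ?exprn_gt0 ?Q_gt0 //.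
apply: lt_le_trans (archi_boundP _) _; first by rewrite invr_ge0 ltW.
apply: le_trans (_ : n%:R <= _); first by rewrite ler_nat.
by rewrite -natrX ler_nat ltnW // ltn_expl // qF_gt1.
Qed.

(** * Limits for a non-archimedean absolute value *)

Section Limits.
Implicit Types (u v : nat -> K) (l : K).

Lemma cvgK_near u l l' (B : R) : cvgK absv u l -> 0 <= B ->
  (forall N, exists2 n, (N <= n)%N & absv (u n - l') <= B) -> absv (l - l') <= B.
Proof.
move=> cu B0 h; rewrite leNgt; apply/negP => lt.
have [N hN] := cu _ (le_lt_trans B0 lt).
have [n hn hB] := h N; move: (hN _ hn); rewrite absv_distC => h1.
have := absvD_lt h1 (le_lt_trans hB lt).
by rewrite addrA subrK ltxx.
Qed.

Lemma cvgK_unique u l l' : cvgK absv u l -> cvgK absv u l' -> l = l'.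
Proof.
move=> cu cu'; apply/eqP; rewrite -subr_eq0 -absv_eq0 eq_le absv_ge0 andbT.
rewrite leNgt; apply/negP => lt.
have [N hN] := cu _ lt; have [N' hN'] := cu' _ lt.
have := hN _ (leq_maxl N N'); rewrite absv_distC => h1.
have := absvD_lt h1 (hN' _ (leq_maxr N N')).
by rewrite addrA subrK ltxx.
Qed.

Lemma cvgK_bound u l : cvgK absv u l -> exists2 B, 0 < B &
  exists N, forall n, (N <= n)%N -> absv (u n) <= B.
Proof.
move=> cu; exists (Num.max 1 (absv l)); first by rewrite lt_max ltr01.
have [N hN] := cu 1 ltr01; exists N => n hn.
rewrite -(subrK l (u n)); apply: absvD_le; last by rewrite le_max lexx orbT.
by rewrite le_max ltW ?hN.
Qed.

Lemma cvgK_cst l : cvgK absv (fun=> l) l.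
Proof. by move=> e e0; exists 0%N => n _; rewrite subrr absv0. Qed.

Lemma cvgKB u v l l' : cvgK absv u l -> cvgK absv v l' ->
  cvgK absv (fun n => u n - v n) (l - l').
Proof.
move=> cu cv e e0; have [N hN] := cu e e0; have [N' hN'] := cv e e0.
exists (maxn N N') => n; rewrite geq_max => /andP[h h'].
have -> : u n - v n - (l - l') = u n - l - (v n - l') by ring.
by apply: absvB_lt; [exact: hN|exact: hN'].
Qed.

Lemma cvgKM u v l l' : cvgK absv u l -> cvgK absv v l' ->
  cvgK absv (fun n => u n * v n) (l * l').
Proof.
move=> cu cv e e0; have [B B0 [N0 hB]] := cvgK_bound cu.
have B'0 : 0 < absv l' + 1 by rewrite ltr_wpDl ?absv_ge0.
have [N hN] := cu _ (divr_gt0 e0 B'0); have [N' hN'] := cv _ (divr_gt0 e0 B0).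
exists (maxn N0 (maxn N N')) => n; rewrite !geq_max => /and3P[h0 h h'].
have -> : u n * v n - l * l' = u n * (v n - l') + (u n - l) * l' by ring.
apply: absvD_lt; rewrite absvM.
  apply: le_lt_trans (_ : B * absv (v n - l') < e).
    by rewrite ler_wpM2r ?absv_ge0 ?hB.
  by rewrite mulrC -ltr_pdivlMr ?hN'.
apply: le_lt_trans (_ : absv (u n - l) * (absv l' + 1) < e).
  by rewrite ler_wpM2l ?absv_ge0 // lerDl ler01.
by rewrite -ltr_pdivlMr ?hN.
Qed.

Lemma cvgKX u l m : cvgK absv u l -> cvgK absv (fun n => u n ^+ m) (l ^+ m).
Proof.
move=> cu; elim: m => [|m IH]; first by exact: cvgK_cst.
by move=> e e0; have [N h] := cvgKM cu IH e0; exists N => n /h; rewrite !exprS.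
Qed.

Lemma cvgK_absv_eq u l : cvgK absv u l -> l != 0 ->
  exists N, forall n, (N <= n)%N -> absv (u n) = absv l.
Proof.
move=> cu l0; have a0 : 0 < absv l by rewrite absv_gt0.
by have [N h] := cu _ a0; exists N => n /h /absvD_eqr; rewrite subrK.
Qed.

Lemma cvgKV u l : l != 0 -> cvgK absv u l -> cvgK absv (fun n => (u n)^-1) l^-1.
Proof.
move=> l0 cu e e0; have a0 : 0 < absv l by rewrite absv_gt0.
have [N h] := cvgK_absv_eq cu l0.
have [N' h'] := cu _ (mulr_gt0 e0 (mulr_gt0 a0 a0)).
exists (maxn N N') => n; rewrite geq_max => /andP[/h h1 /h' h2].
have u0 : u n != 0 by rewrite -absv_gt0 h1.
have -> : (u n)^-1 - l^-1 = - ((u n - l) / (u n * l)) by field; rewrite u0 l0.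
by rewrite absvN absvM absvV absvM h1 ltr_pdivrMr ?mulr_gt0.
Qed.

Lemma cvgK_shift u l (g : nat -> nat) : (forall n, n <= g n)%N ->
  cvgK absv u l -> cvgK absv (fun n => u (g n)) l.
Proof.
move=> hg cu e e0; have [N h] := cu e e0; exists N => n hn.
by apply: h; apply: leq_trans hn (hg n).
Qed.

Lemma cvgK_ext u v l : u =1 v -> cvgK absv u l -> cvgK absv v l.
Proof. by move=> uv cu e e0; have [N h] := cu e e0; exists N => n; rewrite -uv => /h. Qed.

(** In the ultrametric setting, increments tending to 0 already make a sequence Cauchy. *)
Lemma cvgK_increments u :
  (forall n, absv (u n.+1 - u n) <= Q ^ (- n%:Z)) -> exists l, cvgK absv u l.
Proof.
move=> hu; have [_ [_ [_ [_ [_ [complete _]]]]]] := HK; apply: complete => e e0.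
have [N hN] := Qpow_small e0; exists N.
have tail n k : (N <= n)%N -> absv (u (n + k)%N - u n) < e.
  move=> hn; elim: k => [|k IH]; first by rewrite addn0 subrr absv0.
  rewrite addnS -[u _.+1](subrK (u (n + k)%N)) -addrA; apply: absvD_lt IH.
  by apply: le_lt_trans (hu _) (hN _ _); lia.
move=> m n hm hn; case/orP: (leq_total m n) => h; last by rewrite -(subnKC h) tail.
by rewrite absv_distC -(subnKC h) tail.
Qed.

End Limits.

(** * Lists of monic polynomials *)

Section MonicPolynomials.

Lemma size_sum_coef n (c : 'I_n -> F) :
  (size (\sum_(j < n) (c j)%:P * 'X^j)%R <= n)%N.
Proof.
apply: leq_trans (size_sum _ _ _) _; apply/bigmax_leqP => j _.
by rewrite mul_polyC (leq_trans (size_scale_leq _ _)) // size_polyXn.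
Qed.

Lemma size_mpolyc n (c : {ffun 'I_n -> F}) : size (mpolyc c) = n.+1.
Proof. by rewrite /mpolyc size_polyDl size_polyXn // ltnS size_sum_coef. Qed.

Lemma mpolyc_monic n (c : {ffun 'I_n -> F}) : mpolyc c \is monic.
Proof.
rewrite monicE /mpolyc lead_coefDl ?lead_coefXn //.
by rewrite size_polyXn ltnS size_sum_coef.
Qed.

Lemma poly_expand (p : {poly F}) n : (size p <= n)%N ->
  p = \sum_(j < n) (p`_j)%:P * 'X^j.
Proof.
move=> hp; rewrite -[LHS]coefK poly_def (big_ord_widen n (fun j => p`_j *: 'X^j)) //.
rewrite big_mkcond; apply: eq_bigr => j _; rewrite mul_polyC.
by case: ltnP => // h; rewrite nth_default ?scale0r.
Qed.

Lemma mpolyc_inj n : injective (@mpolyc F n).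
Proof.
move=> c c' /addrI e; apply/ffunP => i; move/(congr1 (fun p : {poly F} => p`_i)): e.
have coefE (g : {ffun 'I_n -> F}) : (\sum_(j < n) (g j)%:P * 'X^j)`_i = g i.
  rewrite coef_sum (bigD1 i) //= coefCM coefXn eqxx mulr1 big1 ?addr0 // => j ji.
  by rewrite coefCM coefXn eq_sym (inj_eq val_inj) (negPf ji) mulr0.
by rewrite !coefE.
Qed.

Lemma mpolyc_surj n (p : {poly F}) : p \is monic -> size p = n.+1 ->
  p = mpolyc [ffun j : 'I_n => p`_j].
Proof.
move=> /monicP; rewrite lead_coefE => lp sp; rewrite sp /= in lp.
rewrite {1}(@poly_expand p n.+1) ?sp // big_ord_recr /= lp mul1r addrC.
by congr (_ + _); apply: eq_bigr => j _; rewrite ffunE.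
Qed.

(** The bound is on the size, so degrees stay below [n]. One list replaces the double sum in
    [zeta_part]. *)
Definition monics n : seq {poly F} :=
  flatten [seq [seq mpolyc c | c <- enum {: {ffun 'I_k -> F}}] | k <- iota 0 n].

Lemma mem_monics n p : (p \in monics n) = (p \is monic) && (size p <= n)%N.
Proof.
apply/flatten_mapP/andP => [[k]|[mp sp]].
  rewrite mem_iota => /andP[_ kn] /mapP[c _ ->].
  by rewrite mpolyc_monic size_mpolyc.
have p0 : (0 < size p)%N by rewrite size_poly_gt0 monic_neq0.
exists (size p).-1; first by rewrite mem_iota /= add0n prednK.
apply/mapP; exists [ffun j : 'I__ => p`_j]; first by rewrite mem_enum.
by apply: mpolyc_surj; rewrite ?prednK.
Qed.

Lemma monics_uniq n : uniq (monics n).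
Proof.
elim: n => // n IH; rewrite /monics -addn1 iotaD map_cat flatten_cat cat_uniq.
rewrite -/(monics n) IH /= cats0 map_inj_uniq ?enum_uniq ?andbT; last exact: mpolyc_inj.
apply/hasPn => p /mapP[c _ ->].
by rewrite mem_monics size_mpolyc ltnn andbF.
Qed.

Lemma sum_monics n (P : pred {poly F}) (G : {poly F} -> K) :
  \sum_(k < n) \sum_(c : {ffun 'I_k -> F} | P (mpolyc c)) G (mpolyc c) =
  \sum_(p <- monics n | P p) G p.
Proof.
rewrite /monics -[X in iota 0 X]subn0 -/(index_iota 0 n).
rewrite big_flatten big_map big_mkord.
by apply: eq_bigr => k _; rewrite big_map big_enum_cond.
Qed.

Lemma sum_monics_recr n (P : pred {poly F}) (G : {poly F} -> K) :
  \sum_(p <- monics n.+1 | P p) G p = \sum_(p <- monics n | P p) G p +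
  \sum_(c : {ffun 'I_n -> F} | P (mpolyc c)) G (mpolyc c).
Proof. by rewrite -!sum_monics big_ord_recr. Qed.

End MonicPolynomials.

Section QuadraticUnit.
Variables (a : {poly F}) (b : F) (f : K).
Local Notation d := (size a).-1.
Hypotheses (a_monic : a \is monic) (d_gt0 : (0 < d)%N) (b_neq0 : b != 0).
Hypothesis f_root : f ^+ 2 - emb a * f - emb b%:P = 0.
Hypothesis f_notin_k : ~ in_k emb f.
Hypothesis absv_f : absv f = Q ^ d%:Z.

(** * Arithmetic in A + A f *)

Definition conjf : K := emb a - f.

(* A pair (u, v) stands for the element u + v f of A + A f. *)
Definition pval (w : {poly F} * {poly F}) : K := emb w.1 + emb w.2 * f.

Definition pconj (w : {poly F} * {poly F}) : K := emb w.1 + emb w.2 * conjf.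

(** Read off from f (u + v f) = b v + (u + a v) f. *)
Definition mulf (w : {poly F} * {poly F}) : {poly F} * {poly F} :=
  (b%:P * w.2, w.1 + a * w.2).

Lemma size_a : size a = d.+1.
Proof. by rewrite prednK // size_poly_gt0 monic_neq0. Qed.

Lemma f_sqr : f ^+ 2 = emb a * f + emb b%:P.
Proof. by apply/eqP; rewrite -subr_eq0 opprD addrA f_root. Qed.

Lemma conjf_sqr : conjf ^+ 2 = emb a * conjf + emb b%:P.
Proof. by rewrite /conjf; ring: f_sqr. Qed.

Lemma f_conjf : f * conjf = - emb b%:P.
Proof. by rewrite /conjf; ring: f_sqr. Qed.

Lemma f_neq0 : f != 0.
Proof. by rewrite -absv_gt0 absv_f Qz_gt0. Qed.

Lemma absv_conjf : absv conjf = Q ^ (- d%:Z).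
Proof.
have /(congr1 absv) := f_conjf; rewrite absvM absvN absv_const // absv_f => h.
by rewrite -invr_expz; apply: (mulfI (lt0r_neq0 (Qz_gt0 d))); rewrite h divff ?gt_eqF ?Qz_gt0.
Qed.

Lemma absv_conjfX n : absv (conjf ^+ n) = Q ^ (- (n * d)%:Z).
Proof. by rewrite absvX absv_conjf exprnP exprz_exp; congr (_ ^ _); lia. Qed.

Lemma pval_mulf w : pval (mulf w) = f * pval w.
Proof. by rewrite /pval /= rmorphD !rmorphM; ring: f_sqr. Qed.

Lemma pconj_mulf w : pconj (mulf w) = conjf * pconj w.
Proof. by rewrite /pconj /= rmorphD !rmorphM; ring: conjf_sqr. Qed.

Lemma emb_eq0 p : (emb p == 0) = (p == 0).
Proof.
apply/eqP/eqP => [e|->]; last exact: raddf0.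
by apply: absv_emb_lt1; rewrite e absv0 ltr01.
Qed.

(** 1 and [f] are linearly independent over k, as [f] is not in k. *)
Lemma pval_inj : injective pval.
Proof.
move=> [u v] [u' v'] e.
have e' : emb (u - u') = emb (v' - v) * f.
  have eu : emb u = emb u' + emb v' * f - emb v * f.
    by apply/eqP; rewrite eq_sym subr_eq eq_sym; exact/eqP.
  by rewrite !rmorphB eu; ring.
have [vv|vv] := eqVneq v' v.
  move/eqP: e'; rewrite vv subrr raddf0 mul0r emb_eq0 subr_eq0 => /eqP ->.
  by [].
case: f_notin_k; exists (u - u'), (v' - v); rewrite subr_eq0 e'.
by split=> //; rewrite mulrAC divff ?mul1r // emb_eq0 subr_eq0.
Qed.

(** The difference [u - u'] is a polynomial of absolute value below 1, hence 0. *)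
Lemma pconj_lt1_unique u u' v :
  absv (pconj (u, v)) < 1 -> absv (pconj (u', v)) < 1 -> u = u'.
Proof.
move=> h h'; apply/eqP; rewrite -subr_eq0; apply/eqP/absv_emb_lt1.
have -> : emb (u - u') = pconj (u, v) - pconj (u', v).
  by rewrite /pconj /= rmorphB; ring.
exact: absvB_lt.
Qed.

(** A small conjugate makes u close to - v f', and |f'| < 1. This crude bound suffices for [a * w.2]
    to dominate [w.1] in [mulf]. *)
Lemma size_reduced w : absv (pconj w) < 1 -> w.2 != 0 ->
  (size w.1 <= size w.2)%N.
Proof.
move=> h v0; rewrite leqNgt; apply/negP => lt.
have : absv (emb w.1) < Q ^ (size w.2)%:Z.
  have -> : emb w.1 = pconj w - emb w.2 * conjf by rewrite /pconj; ring.
  apply: absvB_lt; first by apply: lt_le_trans h _; rewrite -(expr0z Q) leQ.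
  by rewrite absvM absv_emb // absv_conjf -QD ltQ; lia.
by rewrite ltNge absv_emb_ge.
Qed.

(** A square root of the discriminant; x = u + v f has v = (x - x') / [delta]. *)
Definition delta : K := f - conjf.

Lemma absv_delta : absv delta = Q ^ d%:Z.
Proof.
by rewrite /delta addrC absvD_eqr ?absv_f // absvN absv_conjf ltQ; lia.
Qed.

Lemma pval_delta w : pval w = pconj w + emb w.2 * delta.
Proof. by rewrite /pval /pconj /delta; ring. Qed.

Lemma absv_pval w : absv (pconj w) < 1 -> w.2 != 0 ->
  absv (pval w) = Q ^ ((size w.2)%:Z - 1 + d%:Z).
Proof.
move=> h v0; rewrite pval_delta absvD_eqr absvM absv_emb // absv_delta -QD //.
apply: lt_trans h _; rewrite -(expr0z Q) ltQ.
by move: v0; rewrite -size_poly_gt0; lia.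
Qed.

Lemma mulf_monic w : absv (pconj w) < 1 -> w.2 \is monic ->
  (mulf w).2 \is monic /\ size (mulf w).2 = (size w.2 + d)%N.
Proof.
move=> h m; have v0 := monic_neq0 m; have sw := size_reduced h v0.
have am : a * w.2 \is monic by rewrite monicMl.
have sa : size (a * w.2) = (size w.2 + d)%N.
  by rewrite size_monicM // size_a addSn /= addnC.
have lt : (size w.1 < size (a * w.2)%R)%N.
  by rewrite sa (leq_ltn_trans sw) // -[X in (X < _)%N]addn0 ltn_add2l.
by rewrite /= monicE lead_coefDr // addrC size_polyDl // -monicE.
Qed.

Lemma pconj_lt1_iter N w : absv (pconj w) < 1 -> absv (conjf ^+ N * pconj w) < 1.
Proof.
move=> h; rewrite absvM absv_conjfX; apply: le_lt_trans h.
by rewrite ler_piMl ?absv_ge0 // -(expr0z Q) leQ; lia.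
Qed.

Lemma pconj_iter_mulf N w : pconj (iter N mulf w) = conjf ^+ N * pconj w.
Proof. by elim: N => [|N IH]; rewrite ?mul1r //= pconj_mulf IH exprS mulrA. Qed.

Lemma pval_iter_mulf N w : pval (iter N mulf w) = f ^+ N * pval w.
Proof. by elim: N => [|N IH]; rewrite ?mul1r //= pval_mulf IH exprS mulrA. Qed.

Lemma iter_mulf_monic N w : absv (pconj w) < 1 -> w.2 \is monic ->
  (iter N mulf w).2 \is monic /\
  size (iter N mulf w).2 = (size w.2 + N * d)%N.
Proof.
move=> h m; elim: N => [|N [mN sN]]; first by rewrite mul0n addn0.
have := @mulf_monic (iter N mulf w); rewrite pconj_iter_mulf pconj_lt1_iter //=.
by case=> // -> ->; rewrite sN mulSn -addnA (addnC d).
Qed.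

(** Division by [f], N times: each one enlarges the conjugate by q^d, which uses up the surplus N d
    in the exponent. *)
Lemma iter_mulf_surj N s w : w.2 \is monic ->
  absv (pconj w) < Q ^ (- (N * d + s)%:Z) ->
  exists w1, [/\ w1.2 \is monic, absv (pconj w1) < Q ^ (- s%:Z) &
                 iter N mulf w1 = w].
Proof.
elim: N w => [|N IH] w m h; first by exists w.
(* The inverse of [mulf] applied to [w]; it exists because b is a unit. *)
pose w1 := (w.2 - a * (b^-1 *: w.1), b^-1 *: w.1).
have e1 : mulf w1 = w.
  case: {h m} w @w1 => u v; rewrite /mulf /= subrK mul_polyC scalerA.
  by rewrite divff ?scale1r.
have h1 : absv (pconj w1) < Q ^ (- (N * d + s)%:Z).
  rewrite -(ltr_pM2l (Qz_gt0 (- d%:Z))) -{1}absv_conjf -absvM -pconj_mulf e1 -QD.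
  by rewrite (_ : _ + _ = - (N.+1 * d + s)%:Z) //; lia.
have h1' : absv (pconj w1) < 1.
  by apply: lt_le_trans h1 _; rewrite -(expr0z Q) leQ; lia.
(* If [w1.2] vanished, so would [w1.1] and hence [w]. Otherwise [a * w1.2] carries the leading term
   of [w.2], and [a] is monic. *)
have m1 : w1.2 \is monic.
  have v0 : w1.2 != 0.
    apply/eqP => v0; have u0 : w1.1 = 0.
      by apply: absv_emb_lt1; move: h1'; rewrite /pconj v0 raddf0 mul0r addr0.
    by move: (monic_neq0 m); rewrite -e1 /mulf v0 u0 /= mulr0 addr0 eqxx.
  have sw := size_reduced h1' v0.
  move: m; rewrite -e1 /mulf [X in X \is _]/= !monicE lead_coefDr.
    by rewrite mulrC lead_coef_Mmonic.
  rewrite size_monicM // size_a addSn /= (leq_ltn_trans sw) //.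
  by rewrite -[X in (X < _)%N]add0n ltn_add2r.
have [w2 [m2 h2 e2]] := IH _ m1 h1.
by exists w2; split; rewrite //= e2.
Qed.

(* Lambda_eps for q^-(e+1) < eps <= q^-e; see [distA_Lam]. *)
Definition Lam (e : nat) : pred {poly F} :=
  fun v => `[< exists u, absv (pconj (u, v)) < Q ^ (- e%:Z) >].

(* The integral part of - v f', meaningful (and unique) only if [Lam 0 v]. *)
Definition upart (v : {poly F}) : {poly F} :=
  xget 0 [set u | absv (pconj (u, v)) < 1].

Lemma Q_Nle1 (e : nat) : Q ^ (- e%:Z) <= 1.
Proof. by rewrite -(expr0z Q) leQ; lia. Qed.

Lemma upartE u v : absv (pconj (u, v)) < 1 -> upart v = u.
Proof.
move=> h; apply: (@pconj_lt1_unique _ _ v); last exact: h.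
exact: (@xgetPex _ 0 [set u | absv (pconj (u, v)) < 1]) (ex_intro _ u h).
Qed.

Lemma LamP e v : reflect (absv (pconj (upart v, v)) < Q ^ (- e%:Z)) (Lam e v).
Proof.
apply: (iffP (asboolP _)) => [[u h]|h]; last by exists (upart v).
by rewrite (@upartE u) // (lt_le_trans h (Q_Nle1 e)).
Qed.

Lemma Lam_lt1 e v : Lam e v -> absv (pconj (upart v, v)) < 1.
Proof. by move=> /LamP h; apply: lt_le_trans h (Q_Nle1 e). Qed.

(** As f = a - f', the difference v f - p is minus the conjugate of the pair (p - a v, v). *)
Lemma distA_Lam (eps : R) e v : Q ^ (- e%:Z - 1) < eps -> eps <= Q ^ (- e%:Z) ->
  (distA emb absv (emb v * f) < eps) = Lam e v.
Proof.
move=> lo hi.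
have E p : emb v * f - emb p = - pconj (p - a * v, v).
  by rewrite /pconj /conjf /= rmorphB rmorphM; ring.
apply/idP/asboolP => [|[u h]].
  case/inf_lt; first by exists (absv (emb v * f - emb 0)), 0.
  move=> _ [p _ <-]; rewrite E absvN => h.
  by exists (p - a * v); apply: lt_le_trans h hi.
(* Nonzero absolute values are powers of q, so a conjugate below q^-e is at most q^(-e-1) < [eps].
   This keeps the inequality strict for the infimum. *)
apply: le_lt_trans lo; move: h; rewrite absv_lt_discrete; apply: le_trans.
rewrite -[u](addrK (a * v)) -absvN -E; apply: ge_inf.
  by exists 0 => _ [p _ <-]; exact: absv_ge0.
by exists (u + a * v).
Qed.

(** The level is n - 1 for the least n with q^-n < [eps]; [eps <= 1] excludes n = 0. *)
Lemma eps_level (eps : R) : 0 < eps -> eps <= 1 ->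
  exists e : nat, Q ^ (- e%:Z - 1) < eps /\ eps <= Q ^ (- e%:Z).
Proof.
move=> e0 e1; have [N hN] := Qpow_small e0.
have ex : exists n, Q ^ (- n%:Z) < eps by exists N; apply: hN.
case: (ex_minnP ex) => [[|n]] h hmin.
  by move: h; rewrite expr0z ltNge e1.
exists n; split; first by rewrite (_ : _ - _ = - n.+1%:Z) //; lia.
by rewrite leNgt; apply/negP => /hmin; rewrite ltnn.
Qed.

(** Multiplication by f^N is a bijection: it scales the conjugate by exactly q^(-N d) and raises the
    degree of v by N d, so the truncations match too. *)
Lemma Lam_shift N s n :
  perm_eq [seq v <- monics (n + N * d) | Lam (N * d + s) v]
    [seq (iter N mulf (upart v, v)).2 | v <- monics n & Lam s v].
Proof.
apply: uniq_perm; first by rewrite filter_uniq ?monics_uniq.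
  rewrite map_inj_in_uniq ?filter_uniq ?monics_uniq // => v v'.
  rewrite !mem_filter => /andP[/Lam_lt1 h _] /andP[/Lam_lt1 h' _] e.
  (* Equal second coordinates force equal first ones, both conjugates being below 1; then f^N
     cancels. *)
  have e' : iter N mulf (upart v, v) = iter N mulf (upart v', v').
    rewrite [LHS]surjective_pairing [RHS]surjective_pairing -e; congr (_, _).
    apply: (@pconj_lt1_unique _ _ (iter N mulf (upart v, v)).2).
      by rewrite -surjective_pairing pconj_iter_mulf pconj_lt1_iter.
    by rewrite e -surjective_pairing pconj_iter_mulf pconj_lt1_iter.
  have := congr1 pval e'; rewrite !pval_iter_mulf => /mulfI.
  by rewrite expf_neq0 ?f_neq0 // => /(_ isT) /pval_inj [].
move=> v; apply/idP/mapP; rewrite mem_filter mem_monics.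
  case/and3P => /LamP h m sv.
  have [[u1 v1] /= [m1 h1 e1]] := @iter_mulf_surj N s (_, _) m h.
  have h1' := lt_le_trans h1 (Q_Nle1 s).
  exists v1; last by rewrite (upartE h1') e1.
  rewrite mem_filter mem_monics m1.
  have [_] := @iter_mulf_monic N (_, _) h1' m1; rewrite e1 /= => s1.
  by rewrite s1 leq_add2r in sv; rewrite sv !andbT; apply/asboolP; exists u1.
case=> v1; rewrite mem_filter mem_monics => /and3P[L1 m1 s1] ->.
have [-> ->] := @iter_mulf_monic N (_, _) (Lam_lt1 L1) m1.
rewrite leq_add2r s1 !andbT; apply/asboolP.
exists (iter N mulf (upart v1, v1)).1; rewrite -surjective_pairing.
rewrite pconj_iter_mulf absvM absv_conjfX PoszD opprD QD.
by rewrite ltr_pM2l ?Qz_gt0 //; apply/LamP.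
Qed.

(** * The ideals a_i as sets of elements with small conjugate *)

(** The pair of f^(k+1), not of f^k: the iteration starts from f, which is (0, 1). *)
Definition fpow k : {poly F} * {poly F} := iter k mulf (0, 1).

Lemma pval_fpow k : pval (fpow k) = f ^+ k.+1.
Proof. by rewrite pval_iter_mulf /pval /= raddf0 rmorph1 add0r mul1r exprSr. Qed.

Lemma pconj_fpow k : pconj (fpow k) = conjf ^+ k.+1.
Proof. by rewrite pconj_iter_mulf /pconj /= raddf0 rmorph1 add0r mul1r exprSr. Qed.

Lemma fpow_monic k : (fpow k).2 \is monic /\ size (fpow k).2 = (k * d).+1.
Proof.
have h : absv (pconj (0, 1)) < 1.
  rewrite /pconj /= raddf0 rmorph1 add0r mul1r absv_conjf -(expr0z Q) ltQ; lia.
by have := iter_mulf_monic k h (monic1 _); rewrite /= size_poly1 add1n.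
Qed.

(** An f-adic expansion with polynomial digits. It has no term in f^0, whose conjugate would not be
    small. *)
Definition fcomb k (c : nat -> {poly F}) : {poly F} * {poly F} :=
  (\sum_(i < k) c i * (fpow i).1, \sum_(i < k) c i * (fpow i).2).

Lemma pval_fcomb k c : pval (fcomb k c) = \sum_(i < k) emb (c i) * f ^+ i.+1.
Proof.
rewrite /pval /= !raddf_sum mulr_suml -big_split; apply: eq_bigr => i _ /=.
by rewrite -pval_fpow /pval !rmorphM; ring.
Qed.

Lemma pconj_fcomb k c :
  pconj (fcomb k c) = \sum_(i < k) emb (c i) * conjf ^+ i.+1.
Proof.
rewrite /pconj /= !raddf_sum mulr_suml -big_split; apply: eq_bigr => i _ /=.
by rewrite -pconj_fpow /pconj !rmorphM; ring.
Qed.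

Lemma fcomb_recr k c : fcomb k.+1 c =
  ((fcomb k c).1 + c k * (fpow k).1, (fcomb k c).2 + c k * (fpow k).2).
Proof. by rewrite /fcomb !big_ord_recr. Qed.

Lemma size_fcomb k (c : nat -> {poly F}) : (forall i, (size (c i) <= d)%N) ->
  (size (fcomb k c).2 <= k * d)%N.
Proof.
move=> hc; apply: leq_trans (size_sum _ _ _) _; apply/bigmax_leqP => i _.
have [m s] := fpow_monic i; have [->|c0] := eqVneq (c i) 0; first by rewrite mul0r size_poly0.
rewrite size_Mmonic // s addnS /=; apply: leq_trans (leq_add (hc i) (leqnn _)) _.
by rewrite -mulSn leq_mul2r (ltn_ord i) orbT.
Qed.

(** The lower terms have size at most k d and the top one exceeds it, so the top digit alone gives
    the leading coefficient. *)
Lemma fcomb_monic k (c : nat -> {poly F}) : (forall i, (size (c i) <= d)%N) -> c k \is monic ->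
  (fcomb k.+1 c).2 \is monic.
Proof.
move=> hc mk; have [m s] := fpow_monic k; rewrite fcomb_recr /= monicE lead_coefDr.
  by rewrite -monicE monicMl.
rewrite (leq_ltn_trans (size_fcomb k hc)) // size_Mmonic ?monic_neq0 // s addnS /=.
by rewrite -add1n leq_add2r size_poly_gt0 monic_neq0.
Qed.

Lemma fcomb_monic_inv k (c : nat -> {poly F}) : (forall i, (size (c i) <= d)%N) ->
  (fcomb k.+1 c).2 \is monic -> (k * d < size (fcomb k.+1 c).2)%N -> c k \is monic.
Proof.
move=> hc; have [m s] := fpow_monic k; have sk := size_fcomb k hc.
rewrite fcomb_recr /= => m1 s1.
have [c0|c0] := eqVneq (c k) 0.
  by move: s1; rewrite c0 mul0r addr0 ltnNge sk.
move: m1; rewrite !monicE lead_coefDr ?lead_coef_Mmonic //.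
rewrite (leq_ltn_trans sk) // size_Mmonic // s addnS /=.
by rewrite -add1n leq_add2r size_poly_gt0.
Qed.

Lemma emb_conjfX_le (p : {poly F}) i : (size p <= d)%N ->
  absv (emb p * conjf ^+ i.+1) <= Q ^ (- (i * d)%:Z - 1).
Proof.
move=> sp; rewrite absvM absv_conjfX.
have := absv_emb_le sp; rewrite -(ler_pM2r (Qz_gt0 (- (i.+1 * d)%:Z))) -QD.
by move/le_trans; apply; rewrite leQ; lia.
Qed.

(* The top coefficient is the quotient of w.2 by the coefficient of f in f^(k+1). *)
Lemma fcomb_surj k w : absv (pconj w) < 1 -> (size w.2 <= k * d)%N ->
  exists2 c : nat -> {poly F}, (forall i, (size (c i) <= d)%N) & w = fcomb k c.
Proof.
elim: k w => [|k IH] [u v] /= h sv.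
  move: sv; rewrite mul0n leqn0 size_poly_eq0 => /eqP v0; rewrite v0 in h *.
  have -> : u = 0 by apply: absv_emb_lt1; move: h; rewrite /pconj /= raddf0 mul0r addr0.
  by exists (fun=> 0); [move=> i; rewrite size_poly0|rewrite /fcomb !big_ord0].
have [m s] := fpow_monic k; set p := (fpow k).2 in m s.
have pn0 : p != 0 := monic_neq0 m.
pose ck := v %/ p.
have sck : (size ck <= d)%N.
  by rewrite size_divp // s /= leq_subLR addnC -mulSn.
have ev : v - ck * p = v %% p by rewrite {1}(divp_eq v p) addrC addKr.
(* Removing the top digit keeps the conjugate below 1 and leaves v mod p, of size at most k d, as
   second coordinate. *)
have [|/=|c hc] := IH (u - ck * (fpow k).1, v - ck * p).
- have -> : pconj (u - ck * (fpow k).1, v - ck * p) = pconj (u, v) - emb ck * conjf ^+ k.+1.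
    by rewrite -pconj_fpow /pconj /= !rmorphB !rmorphM; ring.
  apply: absvB_lt => //; apply: le_lt_trans (emb_conjfX_le _ sck) _.
  by rewrite -(expr0z Q) ltQ; lia.
- by rewrite ev -ltnS -s ltn_modp.
move=> e0; have /= e1 := congr1 fst e0; have /= e2 := congr1 snd e0.
pose c' i := if (i < k)%N then c i else if i == k then ck else 0.
exists c'.
  by move=> i; rewrite /c'; case: ifP => // _; case: ifP => // _; rewrite size_poly0.
rewrite fcomb_recr {2 4}/c' ltnn eqxx /fcomb /=; congr (_, _).
  rewrite -[LHS](subrK (ck * (fpow k).1)) e1; congr (_ + _).
  by apply: eq_bigr => i _; rewrite /c' ltn_ord.
rewrite -[LHS](subrK (ck * (fpow k).2)) e2; congr (_ + _).
by apply: eq_bigr => i _; rewrite /c' ltn_ord.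
Qed.

(** Terms after the first have conjugate at most q^(-d-1), so the bound on the sum passes to c_0 f'.
    With |f'| = q^-d it becomes |c_0| < q^(i0+1). *)
Lemma fcomb_size0 i0 k (c : nat -> {poly F}) : (i0 < d)%N -> (forall i, (size (c i) <= d)%N) ->
  absv (pconj (fcomb k.+1 c)) < Q ^ (- (d - 1 - i0)%N%:Z) -> (size (c 0) <= i0.+1)%N.
Proof.
move=> hi0 hc; rewrite pconj_fcomb big_ord_recl => h; rewrite leqNgt; apply/negP => lt.
have h2 : absv (\sum_(i < k) emb (c (lift ord0 i)) * conjf ^+ (lift ord0 i).+1)
    <= Q ^ (- d%:Z - 1).
  apply: absv_sum_le => [|i _]; first by rewrite ltW ?Qz_gt0.
  apply: le_trans (emb_conjfX_le _ (hc _)) _; rewrite leQ lift0; nia.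
have : absv (emb (c 0) * conjf ^+ 1) < Q ^ (- (d - 1 - i0)%N%:Z).
  rewrite -[X in absv X](addrK (\sum_(i < k) emb (c (lift ord0 i)) * conjf ^+ (lift ord0 i).+1)).
  by apply: (absvB_lt h); apply: le_lt_trans h2 _; rewrite ltQ; lia.
rewrite absvM absv_conjfX mul1n ltNge => /negP; apply.
apply: le_trans (_ : Q ^ (i0.+1%:Z) * Q ^ (- d%:Z) <= _); first by rewrite -QD leQ; lia.
by apply: ler_wpM2r; [exact/ltW/Qz_gt0|exact: absv_emb_ge].
Qed.

(** * The ring A_{oo_1} and the ideals a_i *)

Local Notation inA1 := (inA1 emb f d).

Lemma inA1_sum (I : Type) (r : seq I) (P : pred I) (G : I -> K) :
  (forall i, P i -> inA1 (G i)) -> inA1 (\sum_(i <- r | P i) G i).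
Proof.
move=> h; apply: (big_ind inA1) => //.
  by rewrite -(raddf0 emb) -polyC0; exact: A1_const.
exact: A1_add.
Qed.

Lemma inA1_fX k : inA1 (f ^+ k).
Proof.
elim: k => [|k IH]; first by rewrite expr0 -(rmorph1 emb); exact: A1_const.
by rewrite exprS; apply: A1_mul IH; have := A1_gen emb f d_gt0; rewrite expr0 mulr1.
Qed.

Lemma inA1_mulf (p : {poly F}) k : (size p <= d)%N -> inA1 (emb p * f ^+ k.+1).
Proof.
move=> sp; rewrite (poly_expand sp) (rmorph_sum emb) mulr_suml; apply: inA1_sum => j _.
rewrite (rmorphM emb) (rmorphXn emb) exprS -mulrA; apply: A1_mul (A1_const _ _ _ _) _.
by rewrite mulrA [_ * f]mulrC; apply: A1_mul (inA1_fX k); exact: A1_gen.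
Qed.

Lemma inIdeal_fcomb i0 k (c : nat -> {poly F}) : (i0 < d)%N -> (forall i, (size (c i) <= d)%N) ->
  (size (c 0) <= i0.+1)%N -> inIdeal emb f d i0 (pval (fcomb k c)).
Proof.
move=> hi0 hc hc0; rewrite pval_fcomb; case: k => [|k].
  exists (fun=> emb 0%:P); split; first by move=> j; exact: A1_const.
  by rewrite big_ord0 big1 // => j _; rewrite polyC0 raddf0 mul0r.
(* Digit 0 is spread over the generators f T^j by its coefficients. Every later term has a further
   factor f and goes into the coefficient of the generator f. *)
pose y := \sum_(i < k) emb (c i.+1) * f ^+ i.+1.
exists (fun j : 'I_i0.+1 => emb ((c 0)`_j)%:P + (if j == ord0 then y else 0)); split.
  move=> j; apply: A1_add; first exact: A1_const.
  case: ifP => _; last by rewrite -(raddf0 emb) -polyC0; exact: A1_const.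
  by apply: inA1_sum => i _; exact: inA1_mulf.
under [RHS]eq_bigr do rewrite mulrDl.
rewrite big_split /= big_ord_recl; congr (_ + _).
  rewrite {1}(poly_expand hc0) (rmorph_sum emb) mulr_suml; apply: eq_bigr => j _.
  by rewrite (rmorphM emb) (rmorphXn emb) /Tk expr1; ring.
rewrite big_ord_recl /= expr0 mulr1 [X in _ + X]big1 ?addr0; last by move=> j _; rewrite mul0r.
rewrite /y mulr_suml; apply: eq_bigr => i _.
by rewrite -mulrA -exprSr.
Qed.

Lemma pval_mul w w' : exists2 w'', pval w'' = pval w * pval w' & pconj w'' = pconj w * pconj w'.
Proof.
exists (w.1 * w'.1 + b%:P * (w.2 * w'.2), w.1 * w'.2 + w.2 * w'.1 + a * (w.2 * w'.2)).
  by rewrite /pval /= !rmorphD !rmorphM; ring: f_sqr.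
by rewrite /pconj /= !rmorphD !rmorphM; ring: conjf_sqr.
Qed.

Lemma pval_add w w' : exists2 w'', pval w'' = pval w + pval w' & pconj w'' = pconj w + pconj w'.
Proof.
by exists (w.1 + w'.1, w.2 + w'.2); rewrite /pval /pconj /= !rmorphD; ring.
Qed.

Lemma pval_gen j : pval (0, 'X^j) = f * Tk emb ^+ j /\ absv (pconj (0, 'X^j)) = Q ^ (j%:Z - d%:Z).
Proof.
rewrite /pval /pconj /= raddf0 !add0r rmorphXn mulrC; split=> //.
rewrite -rmorphXn absvM absv_emb ?monic_neq0 ?monicXn // size_polyXn absv_conjf -QD.
by have -> : (j.+1%:Z - 1 + - d%:Z = j%:Z - d%:Z :> int) by lia.
Qed.

(** Conjugates of absolute value at most 1 are stable under sums and products, and |f' T^j| =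
    q^(j-d) bounds the generators. *)
Lemma inA1_pconj x : inA1 x -> exists2 w, x = pval w & absv (pconj w) <= 1.
Proof.
elim=> {x} [c|j jd|x y _ [w -> h] _ [w' -> h']|x y _ [w -> h] _ [w' -> h']].
- exists (c%:P, 0); rewrite /pval /pconj /= raddf0 mul0r addr0 //.
  exact: absv_const_le.
- have [e1 e2] := pval_gen j; exists (0, 'X^j); first by rewrite e1.
  by rewrite e2 -(expr0z Q) leQ; lia.
- by have [w'' <- e] := pval_add w w'; exists w''; rewrite // e absvD_le.
- have [w'' <- e] := pval_mul w w'; exists w''; rewrite // e absvM.
  by rewrite mulr_ile1 ?absv_ge0.
Qed.

(** For j <= i0 the generator f T^j has conjugate at most q^(i0-d), one factor q below the bound;
    coefficients do not enlarge it. *)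
Lemma inIdeal_pconj i0 x : (i0 < d)%N -> inIdeal emb f d i0 x ->
  exists2 w, x = pval w & absv (pconj w) < Q ^ (- (d - 1 - i0)%N%:Z).
Proof.
move=> hi0 [r [hr ->]]; apply: (big_ind (fun x => exists2 w, x = pval w &
  absv (pconj w) < Q ^ (- (d - 1 - i0)%N%:Z))).
- exists (0, 0); rewrite /pval /pconj /= raddf0 mul0r addr0 //.
  by rewrite absv0 Qz_gt0.
- move=> _ _ [w -> h] [w' -> h']; have [w'' <- e] := pval_add w w'.
  by exists w''; rewrite // e absvD_lt.
move=> j _; have [w -> h] := inA1_pconj (hr j); have [<- e2] := pval_gen j.
have [w'' <- e] := pval_mul w (0, 'X^j); exists w''; rewrite // e absvM e2.
apply: le_lt_trans (_ : 1 * Q ^ (j%:Z - d%:Z) < _).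
  by rewrite ler_wpM2r // ltW ?Qz_gt0.
by rewrite mul1r ltQ; have := ltn_ord j; lia.
Qed.

(** * Monic elements of the ideals *)

Lemma size_polyv n (v : 'rV[F]_n) : (size (polyv v) <= n)%N.
Proof. exact: size_sum_coef. Qed.

Lemma polyv_surj n (p : {poly F}) : (size p <= n)%N -> p = polyv (\row_(j < n) p`_j).
Proof.
by move=> sp; rewrite {1}(poly_expand sp); apply: eq_bigr => j _; rewrite mxE.
Qed.

Lemma elemA_fcomb k c0 (cs : {ffun 'I_k.+1 -> 'rV[F]_d}) :
  elemA emb f c0 cs = pval (c0%:P + (fcomb k.+1 (fun i => polyv (cs (inord i)))).1,
                            (fcomb k.+1 (fun i => polyv (cs (inord i)))).2).
Proof.
set w := fcomb _ _; have -> : pval (c0%:P + w.1, w.2) = emb c0%:P + pval w.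
  by rewrite /pval /= rmorphD addrA.
by rewrite pval_fcomb; congr (_ + _); apply: eq_bigr => i _; rewrite inord_val.
Qed.

Lemma elemA_in_list k N c0 (cs : {ffun 'I_k.+1 -> 'rV[F]_d}) : (k < N)%N ->
  polyv (cs ord_max) \is monic -> elemA emb f c0 cs \in monicA_list emb f d N.
Proof.
move=> kN mk; rewrite inE; apply/orP; right.
apply/flatten_mapP; exists k; first by rewrite mem_iota.
by apply/allpairsP; exists (c0, cs); rewrite mem_enum mem_filter mk mem_enum.
Qed.

Lemma in_monicA_list N x : x \in monicA_list emb f d N -> x = 1 \/
  exists k c0 (cs : {ffun 'I_k.+1 -> 'rV[F]_d}),
    [/\ (k < N)%N, polyv (cs ord_max) \is monic & x = elemA emb f c0 cs].
Proof.
rewrite inE => /orP[/eqP|/flatten_mapP[k]]; first by left.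
rewrite mem_iota => /andP[_ kN] /allpairsP[[c0 cs] /= [_ h ->]]; right.
by exists k, c0, cs; move: h; rewrite mem_filter => /andP[].
Qed.

(** An element of the ideal is determined by its second coordinate v. Through the f-adic expansion,
    a monic top digit means v monic, and top index below N means size v at most N d. *)
Lemma monicA_ideal_perm i0 N : (i0 < d)%N ->
  perm_eq [seq x <- undup (monicA_list emb f d N) |
             (x != 0) && `[< inIdeal emb f d i0 x >]]
    [seq pval (upart v, v) | v <- monics (N * d) & Lam (d - 1 - i0) v].
Proof.
move=> hi0; apply: uniq_perm; first by rewrite filter_uniq ?undup_uniq.
  by rewrite map_inj_uniq ?filter_uniq ?monics_uniq // => v v' /pval_inj[].
move=> x; apply/idP/mapP; rewrite mem_filter mem_undup.
  case/andP => /andP[_ /asboolP /(inIdeal_pconj hi0)[w -> h]].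
  have h1 := lt_le_trans h (Q_Nle1 _).
  case/in_monicA_list => [e|[k [c0 [cs [kN mk e]]]]].
    (* The element 1 counts as monic, but its conjugate 1 keeps it out of the ideal. *)
    have w1 : w = (1, 0) by apply: pval_inj; rewrite e /pval /= raddf0 rmorph1 mul0r addr0.
    by move: h1; rewrite w1 /pconj /= raddf0 rmorph1 mul0r addr0 absv1 ltxx.
  have hc i : (size (polyv (cs (inord i))) <= d)%N by exact: size_polyv.
  (* The constant [c0] enters only the first coordinate, so v does not see it. *)
  rewrite elemA_fcomb in e; move/pval_inj: e => e.
  exists w.2; last by rewrite (@upartE w.1) -surjective_pairing.
  rewrite mem_filter mem_monics; apply/and3P; split.
  - by apply/asboolP; exists w.1; rewrite -surjective_pairing.
  - rewrite e /= (@fcomb_monic _ (fun i => polyv (cs (inord i)))) //.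
    by rewrite -[k in inord k]/(val (@ord_max k)) inord_val.
  - rewrite e /=; apply: leq_trans (@size_fcomb _ (fun i => polyv (cs (inord i))) _) _ => //.
    by rewrite leq_mul2r kN orbT.
case=> v; rewrite mem_filter mem_monics => /and3P[L m sv] ->.
have h := Lam_lt1 L; have v0 := monic_neq0 m.
have sv0 : (0 < size v)%N by rewrite size_poly_gt0.
(* The index of the top digit, characterised by k d < size v <= (k + 1) d. *)
pose k := ((size v).-1 %/ d)%N.
have kN : (k < N)%N by rewrite /k ltn_divLR //; lia.
have sk : (k * d < size v <= k.+1 * d)%N.
  rewrite /k; have := divn_eq (size v).-1 d; have := ltn_pmod (size v).-1 d_gt0.
  rewrite mulSn; lia.
case/andP: sk => sk1 sk2.
have [c hc ec] := @fcomb_surj k.+1 (upart v, v) h sk2.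
have hc0 : (size (c 0) <= i0.+1)%N.
  by apply: (@fcomb_size0 _ k) => //; rewrite -ec; apply/LamP.
have mk : c k \is monic.
  by apply: fcomb_monic_inv => //; rewrite -ec.
rewrite -absv_eq0 absv_pval // gt_eqF ?Qz_gt0 //=; apply/andP; split.
  by apply/asboolP; rewrite ec; exact: inIdeal_fcomb.
pose cs : {ffun 'I_k.+1 -> 'rV[F]_d} := [ffun i : 'I_k.+1 => \row_(j < d) (c i)`_j].
have csE i : polyv (cs i) = c i by rewrite ffunE -polyv_surj.
suff -> : pval (upart v, v) = elemA emb f 0 cs by rewrite elemA_in_list // csE.
rewrite ec pval_fcomb /elemA polyC0 raddf0 add0r.
by apply: eq_bigr => i _; rewrite csE.
Qed.

(** * Comparison of the zeta functions *)

(** The zeta sum of a_(d-1-s), indexed by second coordinates for a termwise comparison with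
    [Lam_sum]. *)
Definition ideal_sum s m n : K :=
  \sum_(v <- monics n | Lam s v) pval (upart v, v) ^- m.

Definition Lam_sum e m n : K := \sum_(v <- monics n | Lam e v) emb v ^- m.

Lemma zetaA_partE i0 m N : (i0 < d)%N ->
  zetaA_part emb f d i0 m N = ideal_sum (d - 1 - i0) m (N * d).
Proof.
move=> hi0; rewrite /zetaA_part -big_filter (perm_big _ (monicA_ideal_perm N hi0)).
by rewrite big_map big_filter.
Qed.

Lemma zeta_partE (eps : R) e m N : Q ^ (- e%:Z - 1) < eps -> eps <= Q ^ (- e%:Z) ->
  zeta_part emb absv f eps m N = Lam_sum e m N.+1.
Proof.
move=> lo hi; rewrite /Lam_sum -sum_monics; apply: eq_bigr => n _.
by apply: eq_bigl => c; rewrite (distA_Lam _ lo hi).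
Qed.

Lemma Qz_expr_le (z w : int) m : (0 < m)%N -> z <= 0 -> z <= w -> (Q ^ z) ^+ m <= Q ^ w.
Proof. by move=> m0 z0 zw; rewrite exprnP exprz_exp leQ; nia. Qed.

Lemma absv_pval_inv m (v : {poly F}) n : (0 < m)%N -> v \is monic -> Lam 0 v -> (n < size v)%N ->
  absv (pval (upart v, v) ^- m) <= Q ^ (- n%:Z).
Proof.
move=> m0 mv /Lam_lt1 h sv; rewrite -exprVn absvX absvV absv_pval ?monic_neq0 //.
have {}sv : (n < size (v : seq F))%N := sv.
by rewrite invr_expz; apply: Qz_expr_le => //=; lia.
Qed.

Lemma Lam_Lam0 e v : Lam e v -> Lam 0 v.
Proof. by move=> /Lam_lt1 h; apply/LamP; rewrite expr0z. Qed.

Lemma ideal_sum_cvg s m : (0 < m)%N -> exists l, cvgK absv (ideal_sum s m) l.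
Proof.
move=> m0; apply: cvgK_increments => n.
rewrite /ideal_sum sum_monics_recr addrC addKr.
apply: absv_sum_le => [|c /Lam_Lam0 L]; first by rewrite ltW ?Qz_gt0.
by apply: absv_pval_inv => //; rewrite ?mpolyc_monic ?size_mpolyc.
Qed.

Lemma Lam_sum_cvg e m : (0 < m)%N -> exists l, cvgK absv (Lam_sum e m) l.
Proof.
move=> m0; apply: cvgK_increments => n.
rewrite /Lam_sum sum_monics_recr addrC addKr.
apply: absv_sum_le => [|c L]; first by rewrite ltW ?Qz_gt0.
rewrite -exprVn absvX absvV absv_emb ?monic_neq0 ?mpolyc_monic // invr_expz.
by rewrite size_mpolyc; apply: Qz_expr_le => //; lia.
Qed.

(* x - y = x y (1/y - 1/x), and inverses of elements of norm at least 1 have norm at most 1. *)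
Lemma absv_invX_sub x y m : 1 <= absv x -> 1 <= absv y ->
  absv (x ^- m - y ^- m) <= absv (x - y).
Proof.
move=> hx hy.
have x0 : x != 0 by rewrite -absv_gt0 (lt_le_trans ltr01).
have y0 : y != 0 by rewrite -absv_gt0 (lt_le_trans ltr01).
have ix : absv x^-1 <= 1 by rewrite absvV invf_le1 ?(lt_le_trans ltr01).
have iy : absv y^-1 <= 1 by rewrite absvV invf_le1 ?(lt_le_trans ltr01).
rewrite -!exprVn subrXX absvM.
have h1 : absv (x^-1 - y^-1) <= absv (x - y).
  have -> : x^-1 - y^-1 = - ((x - y) * (x^-1 * y^-1)) by field; rewrite y0 x0.
  by rewrite absvN !absvM ler_piMr ?absv_ge0 // mulr_ile1 ?absv_ge0.
apply: le_trans h1; rewrite ler_piMr ?absv_ge0 //.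
apply: absv_sum_le => // i _; rewrite absvM !absvX mulr_ile1 ?exprn_ge0 ?absv_ge0 //.
  by rewrite exprn_ile1 ?absv_ge0.
by rewrite exprn_ile1 ?absv_ge0.
Qed.

(** If v belongs to x and v' to f^N x, then delta v' / f^N = x - f'^N x' / f^N, where the last term
    is at most q^(-N d). The bound is uniform in [n], so it passes to the limit. *)
Lemma scaled_sum_close N s m n :
  absv ((f ^+ N / delta) ^+ m * Lam_sum (N * d + s) m (n + N * d) - ideal_sum s m n)
  <= Q ^ (- N%:Z).
Proof.
rewrite /Lam_sum -big_filter (perm_big _ (Lam_shift N s n)) big_map big_filter.
rewrite /ideal_sum mulr_sumr -sumrB /= -big_filter.
rewrite big_seq_cond; apply: absv_sum_le => [|v]; first by rewrite ltW ?Qz_gt0.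
rewrite mem_filter mem_monics andbT => /and3P[/Lam_lt1 L m1 _].
set w := (upart v, v) in L *; set w' := iter N mulf w.
have [mw' sw'] := iter_mulf_monic N L (m1 : w.2 \is monic).
have lt1' : absv (pconj w') < 1 by rewrite pconj_iter_mulf pconj_lt1_iter.
have d0 : delta != 0 by rewrite -absv_gt0 absv_delta Qz_gt0.
have fN : f ^+ N != 0 by rewrite expf_neq0 ?f_neq0.
have afN : absv (f ^+ N) = Q ^ (N * d)%:Z.
  by rewrite absvX absv_f exprnP exprz_exp mulnC.
have -> : (f ^+ N / delta) ^+ m * emb w'.2 ^- m = (emb w'.2 * delta / f ^+ N) ^- m.
  move: (f ^+ N) => g; rewrite -!exprVn -exprMn !invfM invrK.
  by congr (_ ^+ _); ring.
have ex : emb w'.2 * delta / f ^+ N = pval w - pconj w' / f ^+ N.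
  have -> : emb w'.2 * delta = pval w' - pconj w' by rewrite pval_delta; ring.
  by rewrite mulrBl pval_iter_mulf mulrAC divff ?mul1r.
have ay : absv (pconj w' / f ^+ N) <= Q ^ (- N%:Z).
  rewrite absvM absvV afN invr_expz.
  apply: le_trans (_ : 1 * Q ^ (- (N * d)%:Z) <= _).
    by rewrite ler_wpM2r ?(ltW lt1') // ltW ?Qz_gt0.
  by rewrite mul1r leQ; nia.
have aw : 1 <= absv (pval w).
  rewrite absv_pval ?monic_neq0 // -(expr0z Q) leQ.
  by have := monic_neq0 m1; rewrite -size_poly_gt0 /=; lia.
(* [absv_invX_sub] asks for absolute values at least 1; for delta v' / f^N, the powers q^(N d) in v'
   and f^N cancel. *)
apply: le_trans (absv_invX_sub m _ aw) _; last by rewrite ex addrAC subrr add0r absvN.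
rewrite absvM absvV absvM afN absv_delta absv_emb ?monic_neq0 // sw' invr_expz -!QD.
by rewrite -(expr0z Q) leQ; have := monic_neq0 m1; rewrite -size_poly_gt0 /=; lia.
Qed.

Lemma scaled_limit_close N s m Z W :
  cvgK absv (Lam_sum (N * d + s) m) Z -> cvgK absv (ideal_sum s m) W ->
  absv ((f ^+ N / delta) ^+ m * Z - W) <= Q ^ (- N%:Z).
Proof.
move=> cZ cW; rewrite -[X in absv X]subr0.
apply: (cvgK_near (cvgKB (cvgKM (cvgK_cst ((f ^+ N / delta) ^+ m))
  (@cvgK_shift _ _ (fun n => n + N * d)%N (fun n => leq_addr _ _) cZ)) cW)).
  exact/ltW/Qz_gt0.
by move=> n; exists n; rewrite // subr0 scaled_sum_close.
Qed.

(* The summand v = 1, for which pval is f, dominates all the others. *)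
Lemma ideal_limit_neq0 s m W : (s < d)%N -> (0 < m)%N ->
  cvgK absv (ideal_sum s m) W -> W != 0.
Proof.
move=> sd m0 cW.
(* [s < d] puts v = 1 into [Lam s], as |f'| = q^-d. *)
have h1 : absv (pconj (0, 1)) < Q ^ (- s%:Z).
  by rewrite /pconj /= raddf0 rmorph1 add0r mul1r absv_conjf ltQ; lia.
have u1 : upart 1 = 0 by apply: upartE; apply: lt_le_trans h1 (Q_Nle1 s).
have L1 : Lam s 1 by apply/asboolP; exists 0.
have B0 : 0 <= Q ^ (- (d * m)%:Z - 1) by exact/ltW/Qz_gt0.
have : absv (W - f ^- m) <= Q ^ (- (d * m)%:Z - 1).
  apply: (cvgK_near cW B0) => n; exists n.+1; rewrite // /ideal_sum big_mkcond.
  rewrite (bigD1_seq 1) ?monics_uniq ?mem_monics ?monic1 ?size_poly1 //= L1 u1.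
  have -> : pval (0, 1) = f by rewrite /pval /= raddf0 rmorph1 add0r mul1r.
  rewrite addrAC subrr add0r.
  rewrite big_seq_cond; apply: absv_sum_le => // v /andP[].
  rewrite mem_monics => /andP[mv _] v1; case: ifP => L; last by rewrite absv0.
  (* A monic v other than 1 has positive degree, which makes its summand smaller by a factor of at
     least q^m. *)
  have sv : (1 < size (v : seq F))%N.
    rewrite ltnNge; apply: contra v1 => /size1_polyC vc.
    by move: mv; rewrite vc monicE lead_coefC => /eqP ->.
  rewrite -exprVn absvX absvV absv_pval ?monic_neq0 ?(Lam_lt1 L) // invr_expz.
  by rewrite exprnP exprz_exp leQ /=; nia.
apply: contraTneq => ->; rewrite add0r absvN absvV absvX absv_f -ltNge.
by rewrite exprnP exprz_exp invr_expz ltQ; lia.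
Qed.

(** * Limits of j-invariants *)

Lemma zetaA_cvg i0 m W : (i0 < d)%N -> cvgK absv (ideal_sum (d - 1 - i0) m) W ->
  is_zetaA emb absv f d i0 m W.
Proof.
move=> hi0 cW; have hg n : (n <= n * d)%N by rewrite leq_pmulr.
by apply: (cvgK_ext _ (cvgK_shift hg cW)) => N; rewrite zetaA_partE.
Qed.

Lemma zeta_cvg (eps : R) e m Z : Q ^ (- e%:Z - 1) < eps -> eps <= Q ^ (- e%:Z) ->
  cvgK absv (Lam_sum e m) Z -> is_zeta emb absv f eps m Z.
Proof.
move=> lo hi cZ; apply: (cvgK_ext _ (cvgK_shift leqnSn cZ)) => N.
by rewrite (zeta_partE _ _ lo hi).
Qed.

(** Homogeneity of degree 0, from q^2 - 1 = (q - 1)(q + 1). *)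
Lemma J_of_scale c Z1 Z2 : c != 0 ->
  J_of emb (c ^+ (q - 1) * Z1) (c ^+ (q ^ 2 - 1) * Z2) = J_of emb Z1 Z2.
Proof.
move=> c0; rewrite /J_of; congr (_ * _).
have -> : (q ^ 2 - 1 = (q - 1) * q.+1)%N by have := qF_gt1; nia.
rewrite exprMn -exprM -mulf_div divff ?mul1r //.
by rewrite expf_neq0.
Qed.

(** Inversion is continuous into k_oo with oo added; for [l = 0] the inverses leave every ball. *)
Lemma cvgP1_inv (D : nat -> K) l : cvgK absv D l ->
  cvgP1 absv (fun k => if D k == 0 then None else Some (D k)^-1)
    (if l == 0 then None else Some l^-1).
Proof.
move=> cD; have [l0|l0] := eqVneq l 0.
  move=> M; have M1 : 0 < Num.max M 1 by rewrite lt_max ltr01 orbT.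
  have iM : 0 < (Num.max M 1)^-1 by rewrite invr_gt0.
  have [N hN] := cD _ iM; exists N => n /hN; rewrite l0 subr0.
  case: eqVneq => // D0; rewrite absvV => h; apply: le_lt_trans (_ : Num.max M 1 < _).
    by rewrite le_max lexx.
  by rewrite -[X in X < _]invrK ltf_pV2 ?posrE ?absv_gt0.
move=> e e0; have [N hN] := cvgKV l0 cD e0; have [N' hN'] := cvgK_absv_eq cD l0.
exists (maxn N N') => n; rewrite geq_max => /andP[/hN h /hN' h'].
exists (D n)^-1; split=> //; case: eqVneq => // D0.
by move: h'; rewrite D0 absv0 => /esym/eqP; rewrite absv_eq0 (negPf l0).
Qed.

Lemma cvgP1_ext u v z : u =1 v -> cvgP1 absv u z -> cvgP1 absv v z.
Proof. by move=> /funext ->. Qed.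

Lemma cvgP1_unique u z z' : cvgP1 absv u z -> cvgP1 absv u z' -> z = z'.
Proof.
(* A term larger than both 1 and [absv l] cannot lie within 1 of [l]. *)
have mixed l : cvgP1 absv u (Some l) -> cvgP1 absv u None -> False.
  move=> h h'; have [N hN] := h 1 ltr01.
  have [N' hN'] := h' (Num.max 1 (absv l)).
  have [y [e h1]] := hN _ (leq_maxl N N').
  have := hN' _ (leq_maxr N N'); rewrite e gt_max => /andP[y1 yl].
  have := absvD_lt (lt_trans h1 y1) yl; rewrite subrK ltxx //.
case: z => [l|]; case: z' => [l'|] // h h'; [|by case: (mixed _ h h')|by case: (mixed _ h' h)].
congr Some; apply/eqP; rewrite -subr_eq0 -absv_eq0 eq_le absv_ge0 andbT.
rewrite leNgt; apply/negP => lt.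
have [N hN] := h _ lt; have [N' hN'] := h' _ lt.
have [y [e h1]] := hN _ (leq_maxl N N').
have [y' [e' h2]] := hN' _ (leq_maxr N N').
move: e'; rewrite e => -[yy]; subst y'.
rewrite absv_distC in h1; have := absvD_lt h1 h2.
by rewrite addrA subrK ltxx.
Qed.

Lemma cvgP1_shift u z (g : nat -> nat) : (forall n, n <= g n)%N ->
  cvgP1 absv u z -> cvgP1 absv (fun n => u (g n)) z.
Proof.
move=> hg; case: z => [l|] h e; last first.
  by have [N hN] := h e; exists N => n hn; apply: hN; apply: leq_trans hn (hg n).
move=> e0; have [N hN] := h e e0; exists N => n hn; apply: hN.
exact: leq_trans hn (hg n).
Qed.

(** The factor f^N / delta drops out of J, and the zeta values rescaled by it converge to those of
    the ideal. That [W1] is nonzero makes the quotient converge. *)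
Lemma jeps_cvg (Nf : nat -> nat) s (Z1 Z2 : nat -> K) W1 W2 : (s < d)%N ->
  (forall M, exists N, forall k, (N <= k)%N -> (M <= Nf k)%N) ->
  (forall k, cvgK absv (Lam_sum (Nf k * d + s) (q - 1)) (Z1 k)) ->
  (forall k, cvgK absv (Lam_sum (Nf k * d + s) (q ^ 2 - 1)) (Z2 k)) ->
  cvgK absv (ideal_sum s (q - 1)) W1 -> cvgK absv (ideal_sum s (q ^ 2 - 1)) W2 ->
  cvgP1 absv (fun k => j_of emb (Z1 k) (Z2 k)) (j_of emb W1 W2).
Proof.
move=> sd hN cZ1 cZ2 cW1 cW2.
pose c k := f ^+ Nf k / delta.
have c0 k : c k != 0.
  rewrite mulf_neq0 ?expf_neq0 ?f_neq0 // invr_eq0.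
  by rewrite -absv_gt0 absv_delta Qz_gt0.
have lim m (Z : nat -> K) W : (forall k, cvgK absv (Lam_sum (Nf k * d + s) m) (Z k)) ->
    cvgK absv (ideal_sum s m) W -> cvgK absv (fun k => c k ^+ m * Z k) W.
  move=> cZ cW e e0; have [M hM] := Qpow_small e0; have [N hk] := hN M.
  exists N => k /hk /hM; apply: le_lt_trans; exact: scaled_limit_close.
have W10 : W1 != 0.
  by apply: ideal_limit_neq0 sd _ cW1; rewrite subn_gt0 qF_gt1.
have cJ : cvgK absv (fun k => J_of emb (Z1 k) (Z2 k)) (J_of emb W1 W2).
  apply: (@cvgK_ext (fun k => J_of emb (c k ^+ (q - 1) * Z1 k) (c k ^+ (q ^ 2 - 1) * Z2 k))).
    by move=> k; rewrite J_of_scale.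
  apply: cvgKM; first exact: cvgK_cst.
  apply: cvgKM; first exact: lim.
  apply: cvgKV; first by rewrite expf_neq0.
  exact/cvgKX/lim.
exact: (cvgP1_inv (cvgKB (cvgK_cst _) cJ)).
Qed.

(** * The two inclusions *)

Lemma zeta_exponents_gt0 : (0 < q - 1)%N /\ (0 < q ^ 2 - 1)%N.
Proof. by have := qF_gt1; split; nia. Qed.

(** Some residue s of the levels mod d recurs infinitely often. Along that subsequence j_eps tends
    to j(a_(d-1-s)), which must be the limit of the whole sequence. *)
Lemma jqt_jideal z : jqt emb absv f z ->
  exists i : 'I_d, is_jideal emb absv f d i z.
Proof.
case=> eps [js [eps0 [epslim [hjs cz]]]].
have [N0 hN0] := epslim 1 ltr01.
(* Before [N0], [eps n] may exceed 1 and have no level; the value 0 there is a default. *)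
have [e he] : exists e : nat -> nat, forall n, (N0 <= n)%N ->
    Q ^ (- (e n)%:Z - 1) < eps n /\ eps n <= Q ^ (- (e n)%:Z).
  have ex n : exists en : nat, (N0 <= n)%N ->
      Q ^ (- en%:Z - 1) < eps n /\ eps n <= Q ^ (- en%:Z).
    have [hn|] := leqP N0 n; last by exists 0%N.
    by have [en hen] := eps_level (eps0 n) (ltW (hN0 n hn)); exists en.
  by have [e he] := choice ex; exists e.
have [s sd hs] : exists2 s, (s < d)%N &
    forall M, exists2 n, (maxn M N0 <= n)%N & (e n %% d = s)%N.
  (* Pigeonhole: if every residue stopped occurring beyond some bound, the residue at the maximum of
     these bounds would violate its own. *)
  apply: contrapT => hns.
  have ex (s : 'I_d) : exists M, forall n, (M <= n)%N -> (e n %% d)%N <> s.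
    apply: contrapT => h; apply: hns; exists s => // M.
    apply: contrapT => h'; apply: h; exists (maxn M N0) => n hn es.
    by apply: h'; exists n.
  have [g hg] := choice ex.
  pose n := (\max_(s < d) g s)%N.
  have sn : (e n %% d < d)%N by rewrite ltn_pmod.
  by apply: (hg (Ordinal sn) n) => //; exact: leq_bigmax.
have [phi hphi] : exists phi : nat -> nat, forall M,
    (maxn M N0 <= phi M)%N /\ (e (phi M) %% d = s)%N.
  have ex M : exists n, (maxn M N0 <= n)%N /\ (e n %% d = s)%N.
    by have [n] := hs M; exists n.
  by have [phi h] := choice ex; exists phi.
have hphiM M : (M <= phi M)%N by case: (hphi M); rewrite geq_max => /andP[].
have hphiN M : (N0 <= phi M)%N by case: (hphi M); rewrite geq_max => /andP[].
have ee M : e (phi M) = (e (phi M) %/ d * d + s)%N.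
  by case: (hphi M) => _ <-; rewrite -divn_eq.
have [q1 q2] := zeta_exponents_gt0.
have [Z1 cZ1] := choice (fun k => Lam_sum_cvg (e (phi k)) q1).
have [Z2 cZ2] := choice (fun k => Lam_sum_cvg (e (phi k)) q2).
have [W1 cW1] := ideal_sum_cvg s q1; have [W2 cW2] := ideal_sum_cvg s q2.
have isd : (d - 1 - s < d)%N by lia.
have ss : (d - 1 - (d - 1 - s) = s)%N by lia.
exists (Ordinal isd), W1, W2; split; first by apply: zetaA_cvg; rewrite //= ss.
split; first by apply: zetaA_cvg; rewrite //= ss.
apply: (cvgP1_unique (cvgP1_shift hphiM cz)).
apply: (@cvgP1_ext (fun k => j_of emb (Z1 k) (Z2 k))).
  move=> k; have [Y1 [Y2 [h1 [h2 ->]]]] := hjs (phi k).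
  have [lo hi] := he _ (hphiN k).
  by rewrite (cvgK_unique h1 (zeta_cvg lo hi (cZ1 k))) (cvgK_unique h2 (zeta_cvg lo hi (cZ2 k))).
apply: (@jeps_cvg (fun k => e (phi k) %/ d)%N s) => //; last 2 first.
- by move=> k; rewrite -ee.
- by move=> k; rewrite -ee.
(* Once eps < q^(-M d - 1), the level exceeds M d, so its quotient by d is at least M. *)
move=> M; have [N hN] := epslim _ (Qz_gt0 (- (M * d)%:Z - 1)).
exists N => k hk; rewrite leq_divRL //.
have [lo _] := he _ (hphiN k).
have := lt_trans lo (hN _ (leq_trans hk (hphiM k))); rewrite ltQ; lia.
Qed.

(** The levels can be chosen freely: k d + s with s = d - 1 - i yields a_i for k tending to
    infinity. *)
Lemma jideal_jqt (i : 'I_d) z : is_jideal emb absv f d i z -> jqt emb absv f z.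
Proof.
case=> W1 [W2 [cW1 [cW2 ->]]].
pose s := (d - 1 - i)%N; have sd : (s < d)%N by rewrite /s; have := ltn_ord i; lia.
have [q1 q2] := zeta_exponents_gt0.
have [V1 cV1] := ideal_sum_cvg s q1; have [V2 cV2] := ideal_sum_cvg s q2.
rewrite (cvgK_unique cW1 (zetaA_cvg (ltn_ord i) cV1)).
rewrite (cvgK_unique cW2 (zetaA_cvg (ltn_ord i) cV2)).
have [Z1 cZ1] := choice (fun k => Lam_sum_cvg (k * d + s) q1).
have [Z2 cZ2] := choice (fun k => Lam_sum_cvg (k * d + s) q2).
(* q^-e is the largest eps of level e. *)
exists (fun k => Q ^ (- (k * d + s)%:Z)), (fun k => j_of emb (Z1 k) (Z2 k)).
split; first by move=> k; exact: Qz_gt0.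
split.
  move=> e e0; have [N hN] := Qpow_small e0; exists N => n hn; apply: hN.
  exact: leq_trans hn (leq_trans (leq_pmulr n d_gt0) (leq_addr s _)).
split; last by apply: (@jeps_cvg (fun k => k) s Z1 Z2) => //; move=> M; exists M.
move=> k; exists (Z1 k), (Z2 k).
have lo : Q ^ (- (k * d + s)%:Z - 1) < Q ^ (- (k * d + s)%:Z) by rewrite ltQ; lia.
by split; [|split=> //]; exact: zeta_cvg lo _ _.
Qed.

End QuadraticUnit.
End Kinf.

Theorem theorem4 (F : finFieldType) (R : realType) (K : fieldType)
  (emb : {rmorphism {poly F} -> K}) (absv : K -> R)
  (HK : kinf_axioms emb absv)
  (a : {poly F}) (b : F) (f : K)
  (Ha : a \is monic) (Hd : (1 <= (size a).-1)%N) (Hb : b != 0)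
  (Hroot : f ^+ 2 - emb a * f - emb b%:P = 0)
  (Hnk : ~ in_k emb f)
  (Habs : absv f = ((qF F)%:R : R) ^+ (size a).-1) :
  forall z : option K,
    jqt emb absv f z <->
    exists i : 'I_((size a).-1), is_jideal emb absv f (size a).-1 i z.
Proof.
move=> z; rewrite exprnP in Habs; split => [h|[i h]].
  exact: (jqt_jideal HK Ha Hd Hb Hroot Hnk Habs h).
exact: (jideal_jqt HK Ha Hd Hb Hroot Hnk Habs h).
Qed.
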